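(* Let $N \geq 1$, $\alpha > 0$, and let $w \in \mathbb{R}^N$ be a weight vector with non-negative entries. Let either $y \in \mathbb{R}^N$ and $V = \mathrm{Val}(y)$ (real-valued case), or $y \in \mathbb{T}^N$ and $V = \mathrm{Val}(y) \cup \mathrm{Val}(\tilde y)$, where $\tilde y$ is the tuple of antipodal points of $y$ (circle-valued case). Let $K$ be the number of elements of $V$. Then the algorithm $\mathrm{L1TV}$ defined in the context computes a global minimizer of the $L^1$-TV problem, that is, an element of $$\arg\min_{x \in \mathbb{R}^N} \; \alpha \sum_{n=1}^{N-1} |x_n - x_{n+1}| + \sum_{n=1}^N w_n |x_n - y_n|$$ in the real-valued case, and an element of $$\arg\min_{x \in \mathbb{T}^N} \; \alpha \sum_{n=1}^{N-1} d_{\mathbb{T}}(x_n, x_{n+1}) + \sum_{n=1}^N w_n\, d_{\mathbb{T}}(x_n, y_n)$$ in the circle-valued case, in $O(KN)$ operations. In particular, if the data are quantized to a finite set (i.e. the entries of $y$ lie in a fixed finite set independent of $N$), then the algorithm needs $O(N)$ operations, both for real-valued and for circle-valued signals.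
   Context: $\mathbb{T} = \mathbb{S}^1$ is the unit circle, $d_{\mathbb{T}}$ is the arc length distance on $\mathbb{T}$, and points of $\mathbb{T}$ are represented by their angles in $(-\pi,\pi]$. For a tuple $y$, $\mathrm{Val}(y) = \{y_1,\ldots,y_N\}$ is its set of values; in the circle-valued case $\tilde y_n$ is the antipodal point of $y_n$. Let $d(u,v) = |u-v|$ in the real-valued case and $d = d_{\mathbb{T}}$ in the circle-valued case. Subroutine $\mathrm{distTransReal}(B,v,\alpha)$, for $B, v \in \mathbb{R}^M$, $v$ sorted ascendingly: set $D \leftarrow B$; for $k = 2,\ldots,M$ (in this order) set $D_k \leftarrow \min(D_{k-1} + \alpha(v_k - v_{k-1}), D_k)$; then for $k = M-1,\ldots,1$ (in this order) set $D_k \leftarrow \min(D_{k+1} + \alpha(v_{k+1}-v_k), D_k)$; return $D$ (entries are overwritten in place). Subroutine $\mathrm{distTransCirc}(B,v,\alpha)$, for $B \in \mathbb{R}^K$, $v \in (-\pi,\pi]^K$ sorted ascendingly: let $B' = (B_1,\ldots,B_K,B_1,\ldots,B_K,B_1,\ldots,B_K)$ and $v' = (v_1-2\pi,\ldots,v_K-2\pi,v_1,\ldots,v_K,v_1+2\pi,\ldots,v_K+2\pi)$; compute $D' = \mathrm{distTransReal}(B',v',\alpha)$; return $(D'_{K+1},\ldots,D'_{2K})$. Algorithm $\mathrm{L1TV}$ (input: $y$, $\alpha$, $w$; output: $\hat x$): 1. (Candidate values) Form the finite set $V$ ($V = \mathrm{Val}(y)$ in the real-valued case, $V = \mathrm{Val}(y)\cup\mathrm{Val}(\tilde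 y)$ in the circle-valued case), and let $v = (v_1,\ldots,v_K)$ be the tuple of its distinct elements sorted in ascending order (by angle in $(-\pi,\pi]$ in the circle-valued case). 2. (Tabulation) Set $B^1_k \leftarrow w_1 d(v_k,y_1)$ for $k=1,\ldots,K$. For $n = 2,\ldots,N$: compute $D \leftarrow \mathrm{distTransReal}(B^{n-1},v,\alpha)$ in the real-valued case, or $D \leftarrow \mathrm{distTransCirc}(B^{n-1},v,\alpha)$ in the circle-valued case; then set $B^n_k \leftarrow w_n d(v_k,y_n) + D_k$ for $k=1,\ldots,K$. 3. (Backtracking) Choose $l \in \arg\min_{k=1,\ldots,K} B^N_k$ and set $\hat x_N \leftarrow v_l$. For $n = N-1, N-2,\ldots,1$: choose $l \in \arg\min_{k=1,\ldots,K} \big( B^n_k + \alpha\, d(v_k,\hat x_{n+1})\big)$ and set $\hat x_n \leftarrow v_l$. Return $\hat x = (\hat x_1,\ldots,\hat x_N)$. Complexity is measured by the number of elementary operations (arithmetic operations, comparisons, assignments and evaluations of $d$ on real numbers or angles, each at unit cost). *)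

(* Defs.v *)
From mathcomp Require Import all_boot all_order all_algebra.
From mathcomp Require Import classical_sets cardinality reals trigo.

Set Implicit Arguments.
Unset Strict Implicit.
Unset Printing Implicit Defensive.

Import Order.TTheory GRing.Theory Num.Theory.
Local Open Scope classical_set_scope.
Local Open Scope ring_scope.

Variant signal := RealValued | CircleValued.

(* A point of the unit circle is represented by its angle in ]-pi, pi]. *)
Definition carrier (R : realType) (s : signal) : set R :=
  match s with
  | RealValued => setT
  | CircleValued => [set t | - pi < t <= pi]
  end.

(* For angles u, v in ]-pi, pi], the two arcs joining u and v have lengths
   `|u - v| and 2 pi - `|u - v|. *)
Definition dist (R : realType) (s : signal) (u v : R) : R :=
  match s with
  | RealValued => `|u - v|
  | CircleValued => Num.min `|u - v| (2 * pi - `|u - v|)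
  end.

Definition antipode (R : realType) (t : R) : R :=
  if 0 < t then t - pi else t + pi.

(* Possibly with repetitions. *)
Definition values (R : realType) (s : signal) (y : seq R) : seq R :=
  match s with
  | RealValued => y
  | CircleValued => y ++ [seq antipode t | t <- y]
  end.

Definition nb_values (R : realType) (s : signal) (y : seq R) : nat :=
  size (undup (values s y)).

Definition signals (R : realType) (s : signal) (N : nat) : set (N.-tuple R) :=
  [set x | forall i, carrier s (tnth x i)].

Definition energy (R : realType) (s : signal) (N : nat) (alpha : R)
    (w y x : N.-tuple R) : R :=
  alpha * (\sum_(i < N.-1) dist s x`_i x`_i.+1)
  + \sum_(i < N) tnth w i * dist s (tnth x i) (tnth y i).

Definition argmin (T : Type) (R : realType) (X : set T) (f : T -> R) : set T :=
  [set x | X x /\ forall z, X z -> f x <= f z].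

(* A computation is a result together with the number of elementary operations
   spent on it.  The only sources of cost are the unit-cost operations below:
   arithmetic, comparisons, evaluations of the distance, and assignments of a
   variable or of one array entry.  All computations on real numbers or angles
   go through them.  Reading a variable or an array entry, loop control and
   index arithmetic are free. *)
Definition timed (A : Type) : Type := (A * nat)%type.

Definition ret (A : Type) (a : A) : timed A := (a, 0%N).

Definition bind (A B : Type) (m : timed A) (f : A -> timed B) : timed B :=
  let: (a, c) := m in let: (b, c') := f a in (b, (c + c')%N).

Notation "'let*' x ':=' m 'in' k" := (bind m (fun x => k))
  (at level 200, x name, m at level 200, k at level 200,
   format "'[v' 'let*'  x  ':='  m  'in' '/' k ']'").

Definition op1 (A : Type) (a : A) : timed A := (a, 1%N).

Definition addM (R : realType) (a b : R) : timed R := op1 (a + b).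
Definition subM (R : realType) (a b : R) : timed R := op1 (a - b).
Definition mulM (R : realType) (a b : R) : timed R := op1 (a * b).
Definition ltM (R : realType) (a b : R) : timed bool := op1 (a < b).
Definition eqM (R : realType) (a b : R) : timed bool := op1 (a == b).
Definition distM (R : realType) (s : signal) (a b : R) : timed R :=
  op1 (dist s a b).
Definition assign (A : Type) (a : A) : timed A := op1 a.
Definition store (R : realType) (D : seq R) (k : nat) (a : R) : timed (seq R) :=
  op1 (set_nth 0 D k a).

Definition minM (R : realType) (a b : R) : timed R :=
  let* c := ltM a b in ret (if c then a else b).

Fixpoint forM (S : Type) (ks : seq nat) (body : nat -> S -> timed S) (st : S)
    : timed S :=
  if ks is k :: ks' then let* st' := body k st in forM ks' body st'
  else ret st.

(* Assigns the entries of a fresh array, one assignment per entry. *)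
Fixpoint mapM (A B : Type) (f : A -> timed B) (s : seq A) : timed (seq B) :=
  if s is a :: s' then
    let* b := f a in
    let* b' := assign b in
    let* t := mapM f s' in
    ret (b' :: t)
  else ret [::].

Definition tabM (B : Type) (n : nat) (f : nat -> timed B) : timed (seq B) :=
  mapM f (iota 0 n).

Definition copyM (A : Type) (s : seq A) : timed (seq A) := mapM (@ret A) s.

(* From here on, array indices and the time index n start at 0. *)

(* D_k <- min(D_j + alpha * h, D_k) *)
Definition relax (R : realType) (alpha : R) (j k : nat) (h : R) (D : seq R)
    : timed (seq R) :=
  let* p := mulM alpha h in
  let* a := addM D`_j p in
  let* m := minM a D`_k in
  store D k m.

Definition distTransReal (R : realType) (B v : seq R) (alpha : R)
    : timed (seq R) :=
  let M := size v in
  let* D := copyM B in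
  let* D := forM (iota 1 M.-1)
    (fun k D => let* h := subM v`_k v`_k.-1 in relax alpha k.-1 k h D) D in
  forM (rev (iota 0 M.-1))
    (fun k D => let* h := subM v`_k.+1 v`_k in relax alpha k.+1 k h D) D.

Definition distTransCirc (R : realType) (B v : seq R) (alpha : R)
    : timed (seq R) :=
  let K := size v in
  let* B' := copyM (B ++ B ++ B) in
  let* twopi := mulM 2 pi in
  let* vl := mapM (fun t => subM t twopi) v in
  let* vm := copyM v in
  let* vr := mapM (fun t => addM t twopi) v in
  let* D' := distTransReal B' (vl ++ vm ++ vr) alpha in
  copyM (take K (drop K D')).

Definition distTrans (R : realType) (s : signal) (B v : seq R) (alpha : R)
    : timed (seq R) :=
  match s with
  | RealValued => distTransReal B v alpha
  | CircleValued => distTransCirc B v alpha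
  end.

(* Meant for an ascending array without repetitions.  Inserting in front of an
   entry shifts that entry and all those after it, at one assignment each. *)
Fixpoint insertM (R : realType) (a : R) (v : seq R) : timed (seq R) :=
  if v is b :: v' then
    let* lt_ab := ltM a b in
    if lt_ab then copyM (a :: v) else
    let* eq_ab := eqM a b in
    if eq_ab then ret v else
    let* u := insertM a v' in
    ret (b :: u)
  else copyM [:: a].

Definition antipodeM (R : realType) (t : R) : timed R :=
  let* pos := ltM 0 t in
  if pos then subM t pi else addM t pi.

Definition valuesM (R : realType) (s : signal) (y : seq R) : timed (seq R) :=
  match s with
  | RealValued => ret y
  | CircleValued => let* y' := mapM (@antipodeM R) y in ret (y ++ y')
  end.

(* Insertion keeps the array ascending and free of repetitions, so the result
   is the sorted tuple of the distinct elements of [values s y]. *)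
Definition candidates (R : realType) (s : signal) (y : seq R)
    : timed (seq R) :=
  let* z := valuesM s y in
  forM (iota 0 (size z)) (fun n v => insertM z`_n v) [::].

Definition tabulate (R : realType) (s : signal) (alpha : R) (w y v : seq R)
    : timed (seq (seq R)) :=
  let K := size v in
  let* B1 := tabM K (fun k => let* e := distM s v`_k y`_0 in mulM w`_0 e) in
  forM (iota 1 (size y).-1)
    (fun n Bs =>
       let* D := distTrans s (nth [::] Bs n.-1) v alpha in
       let* Bn := tabM K (fun k =>
         let* e := distM s v`_k y`_n in
         let* f := mulM w`_n e in
         addM f D`_k) in
       ret (rcons Bs Bn))
    [:: B1].

(* The list of all indices k at which E_k is minimal. *)
Definition argminM (R : realType) (E : seq R) : timed (seq nat) :=
  let* m := assign E`_0 in
  let* m := forM (iota 1 (size E).-1)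
    (fun k m => let* m' := minM E`_k m in assign m') m in
  forM (iota 0 (size E))
    (fun k ls =>
       let* b := eqM E`_k m in
       if b then assign (rcons ls k) else ret ls)
    [::].

(* The backtracking step that determines the entry x_n of the result chooses
   the element [ch n ls] of its list ls of minimal indices.  As the rule may
   depend on n, every possible sequence of choices arises from such a rule. *)
Definition selection (ch : nat -> seq nat -> nat) : Prop :=
  forall n ls, ls != [::] -> ch n ls \in ls.

Definition chooseM (R : realType) (ch : nat -> seq nat -> nat) (n : nat)
    (E : seq R) : timed nat :=
  let* ls := argminM E in assign (ch n ls).

(* The result is filled in from its last entry to its first; x holds the
   entries determined so far, so that its head is x_(n+1). *)
Definition backtrack (R : realType) (ch : nat -> seq nat -> nat) (s : signal)
    (alpha : R) (N : nat) (v : seq R) (Bs : seq (seq R)) : timed (seq R) :=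
  let* l := chooseM ch N.-1 (nth [::] Bs N.-1) in
  let* xN := assign v`_l in
  forM (rev (iota 0 N.-1))
    (fun n x =>
       let* E := tabM (size v) (fun k =>
         let* e := distM s v`_k (head 0 x) in
         let* f := mulM alpha e in
         addM (nth [::] Bs n)`_k f) in
       let* l := chooseM ch n E in
       let* xn := assign v`_l in
       ret (xn :: x))
    [:: xN].

Definition L1TV (R : realType) (ch : nat -> seq nat -> nat) (s : signal)
    (alpha : R) (w y : seq R) : timed (seq R) :=
  let* v := candidates s y in
  let* Bs := tabulate s alpha w y v in
  backtrack ch s alpha (size y) v Bs.

(* Main.v *)
Require Import Defs.
From mathcomp Require Import all_boot all_order all_algebra.
From mathcomp Require Import classical_sets cardinality reals trigo.
From mathcomp Require Import lra zify ring.

Import Order.TTheory GRing.Theory Num.Theory.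
Local Open Scope classical_set_scope.
Local Open Scope ring_scope.

Set Implicit Arguments.
Unset Strict Implicit.
Unset Printing Implicit Defensive.

(** Two facts combine: some minimizer takes its values among those of the data,
    and the algorithm minimizes exactly over the signals with candidate values.

    For the first fact ([data_values_suffice]), let a value [a] of a signal be
    none of the data values, and move all the entries equal to [a] together.
    Each term of the energy depends on the position of these entries as a
    nonnegative multiple of the distance to a fixed point of a finite set that
    does not contain [a]: another value of the signal, or a data value.  On the
    line and on the circle alike, the distance to [c] is concave on every
    segment or arc that has [c] outside its interior, since its only convex kink
    is at [c] itself.  So the energy is concave between the two neighbours of
    [a] in that set ([squeeze]), and moving the entries to one of the neighbours
    does not increase it ([energy_move_value]); an extremal point of the line
    has one neighbour only, and moving towards it decreases all the distances.
    The move removes one value outside the data and creates none, so after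
    finitely many moves only data values are left.

    The second fact is Bellman's principle.  The two passes of the distance
    transform compute, for every candidate [v_k], the minimum over [j] of
    [B_j + alpha * d(v_k, v_j)] ([runs_distTrans]); on the circle this minimum
    is read off from three lifted copies of the candidates, because the arc
    distance is the least distance to the lifts by -2 pi, 0 and 2 pi.  Hence
    each entry of row [n] of the table bounds from below the energy of every
    prefix of length [n + 1] that consists of candidates and ends with the one
    of that entry ([opt_le_prefix_energy]), and the bound is attained along the
    traced signal ([opt_traced]), whatever the choice among minimal indices.

    Every pass over the K candidates costs O(K) and there are O(N) of them.
    Values and costs are established together: the bound on the cost of a pass
    depends on the sizes of the arrays, which the loop invariants provide. *)

(** * Value and cost of a computation *)

(** Value and cost together, because the cost of a pass depends on the sizes of
    the arrays that the previous ones return. *)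
Definition runs (T : Type) (m : timed T) (c : nat) (Q : T -> Prop) : Prop :=
  Q m.1 /\ (m.2 <= c)%N.

Lemma runs_bind (T U : Type) (m : timed T) (f : T -> timed U) c c' P Q :
  runs m c P -> (forall a, P a -> runs (f a) c' Q) ->
  runs (bind m f) (c + c') Q.
Proof.
case: m => a c0 [/= Pa c0c] fQ; have [] := fQ a Pa.
by rewrite /runs /=; case: (f a) => b c1 /= Qb c1c; split=> //; lia.
Qed.

Lemma runs_weaken (T : Type) (m : timed T) c c' (P Q : T -> Prop) :
  runs m c P -> (c <= c')%N -> (forall a, P a -> Q a) -> runs m c' Q.
Proof. by move=> [Pm mc] cc' PQ; split; [apply: PQ|apply: leq_trans cc']. Qed.

Lemma runs_le (T : Type) (m : timed T) c c' Q :
  (c <= c')%N -> runs m c Q -> runs m c' Q.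
Proof. by move=> cc' /runs_weaken; apply. Qed.

Lemma runs_for_up (S : Type) (P : nat -> S -> Prop) m n c
    (body : nat -> S -> timed S) st :
  P m st ->
  (forall k st', (m <= k < m + n)%N -> P k st' ->
     runs (body k st') c (P k.+1)) ->
  runs (forM (iota m n) body st) (n * c) (P (m + n)%N).
Proof.
elim: n m st => [|n IH] m st Pm body_ok; first by split; rewrite /= ?addn0.
rewrite /= mulSn; apply: runs_bind; first by apply: body_ok => //; lia.
rewrite -addSnnS => st' Pst'; apply: IH => // k st'' km; apply: body_ok; lia.
Qed.

Lemma runs_for_down (S : Type) (P : nat -> S -> Prop) n c
    (body : nat -> S -> timed S) st :
  P n st ->
  (forall k st', (k < n)%N -> P k.+1 st' -> runs (body k st') c (P k)) ->
  runs (forM (rev (iota 0 n)) body st) (n * c) (P 0%N).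
Proof.
elim: n st => [|n IH] st Pn body_ok; first by split.
rewrite -[in iota _ _]addn1 iotaD rev_cat /= mulSn.
apply: runs_bind; first exact: body_ok.
by move=> st' Pst'; apply: IH => // k st'' kn; apply: body_ok; lia.
Qed.

Lemma runs_map (T U : eqType) (f : T -> timed U) (g : T -> U) c s :
  (forall a, f a = (g a, c)) ->
  runs (mapM f s) (size s * c.+1) (eq (map g s)).
Proof.
move=> fE; elim: s => [|a s [IHg IHc]] /=; first by split.
rewrite fE /runs /=; case: (mapM f s) IHg IHc => t ct /= -> ctc.
by split=> //; lia.
Qed.

Lemma runs_tab (U : eqType) (f : nat -> timed U) (g : nat -> U) c n :
  (forall k, f k = (g k, c)) -> runs (tabM n f) (n * c.+1) (eq (mkseq g n)).
Proof. by move=> /(@runs_map _ _ _ g c (iota 0 n)); rewrite size_iota. Qed.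

Lemma runs_copy (T : eqType) (s : seq T) : runs (copyM s) (size s) (eq s).
Proof.
by have := @runs_map _ _ (@ret T) id 0 s (fun=> erefl); rewrite map_id muln1.
Qed.

Section Algorithm.
Variable R : realType.
Implicit Types (s : signal) (alpha : R).

(** * The two distances *)

Lemma dist_sym s (u v : R) : dist s u v = dist s v u.
Proof. by case: s => /=; rewrite distrC. Qed.

Lemma dist_refl s (u : R) : dist s u u = 0.
Proof.
case: s => /=; rewrite subrr normr0 ?subr0 // min_l // mulr_ge0 ?pi_ge0 //.
Qed.

(** The point [v + e] is a lift of [v] to the line, and a path from [u] to a
    lift projects to a path on the circle that joins [u] to [v]. *)
Lemma dist_circle_shift (u v : R) (e : R) :
  `|u - v| <= 2 * pi -> e \in [:: - (2 * pi); 0; 2 * pi] ->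
  dist CircleValued u v <= `|u - (v + e)|.
Proof.
have pi0 := pi_gt0 R.
move=> uv /=; rewrite !inE ge_min => /or3P[] /eqP ->; apply/orP.
- by right; rewrite ler_normr; case: ger0P uv => ? ?; apply/orP; left; lra.
- by left; rewrite addr0.
- by right; rewrite ler_normr; case: ger0P uv => ? ?; apply/orP; right; lra.
Qed.

Lemma dist_circle_attained (u v : R) : `|u - v| <= 2 * pi ->
  exists2 e, e \in [:: - (2 * pi); 0; 2 * pi] &
    `|u - (v + e)| <= dist CircleValued u v.
Proof.
move=> uv /=; have [_|_] := leP `|u - v| (2 * pi - `|u - v|).
  by exists 0; rewrite ?addr0 // !inE eqxx orbT.
case: ger0P uv => [uv0|uv0] uv.
  exists (2 * pi); first by rewrite !inE eqxx !orbT.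
  by rewrite ler0_norm; lra.
exists (- (2 * pi)); first by rewrite !inE eqxx.
by rewrite ger0_norm; lra.
Qed.

(** * Minimization over the values of the data *)

Lemma exists_seq_min (f : R -> R) (P : seq R) :
  P != [::] -> exists2 p, p \in P & forall c, c \in P -> f p <= f c.
Proof.
elim: P => [//|a [|b P] IH] _.
  by exists a; rewrite ?mem_head // => c; rewrite inE => /eqP ->.
have [p pP pm] := IH isT.
have [ap|pa] := lerP (f a) (f p).
  exists a; first exact: mem_head.
  by move=> c; rewrite inE => /predU1P[->//|/pm]; apply: le_trans.
exists p; first by rewrite inE pP orbT.
by move=> c; rewrite inE => /predU1P[->|/pm//]; apply: ltW.
Qed.

(** An inequality of concavity without division: [p] and [q] stand for
    the neighbours of [a] in [P] and [A], [B] for the lengths of the segments or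
    arcs from [a] to them, so that [a] is the mean of [p] and [q] with weights
    [B] and [A].  A point of the line with neighbours on one side only takes
    [p = q] and arbitrary weights. *)
Definition squeezed (s : signal) (P : seq R) (a : R) :=
  exists p q A B, [/\ p \in P, q \in P, 0 <= A /\ 0 <= B, 0 < A + B &
    forall c, c \in P ->
      B * dist s p c + A * dist s q c <= (A + B) * dist s a c].

(** Between two neighbours in [P], the distance to a point of [P] is affine;
    outside the convex hull of [P] it decreases towards [P]. *)
Lemma squeeze_real (P : seq R) a :
  P != [::] -> a \notin P -> squeezed RealValued P a.
Proof.
move=> P0 aP.
have side c : c \in P -> c < a \/ a < c.
  by move=> cP; case: (ltgtP c a) => [|| E]; [left|right|rewrite -E cP in aP].
pose l := [seq c <- P | c < a]; pose r := [seq c <- P | a < c].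
have [l0|lN0] := eqVneq l [::].
  have [q qP qm] := exists_seq_min id P0.
  exists q, q, 1, 0; split; rewrite ?addr0 ?lexx ?ler01 ?ltr01 // => c cP /=.
  have ac : a < q.
    have [qa|//] := side q qP.
    by have : q \in l; [rewrite mem_filter qa|rewrite l0].
  have qc : q <= c := qm _ cP.
  by rewrite !ler0_norm; lra.
have [p] := exists_seq_min -%R lN0; rewrite mem_filter => /andP[pa pP] pm.
have {}pm c : c \in P -> c < a -> c <= p.
  by move=> cP ca; rewrite -lerN2; apply: pm; rewrite mem_filter ca.
have [r0|rN0] := eqVneq r [::].
  exists p, p, 1, 0; split; rewrite ?addr0 ?lexx ?ler01 ?ltr01 // => c cP /=.
  have [ca|ac] := side c cP; last first.
    by have : c \in r; [rewrite mem_filter ac|rewrite r0].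
  have cp := pm _ cP ca.
  by rewrite !ger0_norm; lra.
have [q] := exists_seq_min id rN0; rewrite mem_filter => /andP[aq qP] qm.
exists p, q, (a - p), (q - a); split=> //; [split; lra|lra|move=> c cP /=].
have [ca|ac] := side c cP.
  by have cp := pm _ cP ca; rewrite !ger0_norm; lra.
have qc : q <= c by apply: qm; rewrite mem_filter ac.
by rewrite !ler0_norm; lra.
Qed.

(** Measured counterclockwise from [a], the points of [P] have angles [r c] in
    ]0, 2 pi[; the neighbours of [a] are the points of least and of largest
    angle.  Each of the two arcs from [a] to [c] runs towards one neighbour and
    away from the other, so that the weighted changes of its length cancel. *)
Lemma squeeze_circle (P : seq R) a : P != [::] ->
  (forall c, c \in P -> carrier CircleValued c) -> carrier CircleValued a ->
  a \notin P -> squeezed CircleValued P a.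
Proof.
move=> P0 PT /= /andP[a1 a2] aP; have pi0 := pi_gt0 R.
pose r c : R := if a < c then c - a else c - a + 2 * pi.
have rP c : c \in P -> [/\ 0 < r c, r c < 2 * pi &
    r c = c - a \/ r c = c - a + 2 * pi].
  move=> cP; have /= /andP[c1 c2] := PT c cP.
  rewrite /r; have [ac|ca|E] := ltgtP a c.
  - by split; [lra|lra|left].
  - by split; [lra|lra|right].
  - by rewrite E cP in aP.
have [p pP pm] := exists_seq_min (fun c => - r c) P0.
have [q qP qm] := exists_seq_min r P0.
have [p0 p1 pE] := rP _ pP; have [q0 q1 qE] := rP _ qP.
exists p, q, (2 * pi - r p), (r q); split=> //; [split; lra|lra|move=> c cP /=].
have := pm _ cP; rewrite lerN2 => cp; have qc := qm _ cP.
have [c0 c1 cE] := rP _ cP.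
(* The angles are measured from [a] within one turn, so the difference of two of
   them is the length of the arc from [u] to [v] that avoids [a]. *)
have dE u v : u \in P -> v \in P -> r u <= r v ->
    Num.min `|u - v| (2 * pi - `|u - v|) =
    Num.min (r v - r u) (2 * pi - (r v - r u)).
  move=> uP vP uv; have /= /andP[u1 u2] := PT u uP.
  have /= /andP[v1 v2] := PT v vP.
  have [? ? [uE|uE]] := rP u uP; have [? ? [vE|vE]] := rP v vP.
  - by rewrite ler0_norm; [congr Num.min; lra|lra].
  - rewrite ger0_norm; last lra.
    by rewrite minC; congr Num.min; lra.
  - by exfalso; lra.
  - by rewrite ler0_norm; [congr Num.min; lra|lra].
have dP := dE c p cP pP cp.
have dQ := dE q c qP cP qc.
rewrite [`|p - c|]distrC dP dQ.
have -> : Num.min `|a - c| (2 * pi - `|a - c|) = Num.min (r c) (2 * pi - r c).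
  case: cE => cE.
    by rewrite ler0_norm; [congr Num.min; lra|lra].
  rewrite ger0_norm; last lra.
  by rewrite minC; congr Num.min; lra.
set mp := Num.min (r p - _) _; set mq := Num.min (r c - _) _.
have mp1 : mp <= r p - r c by rewrite /mp ge_min lexx.
have mp2 : mp <= 2 * pi - (r p - r c) by rewrite /mp ge_min lexx orbT.
have mq1 : mq <= r c - r q by rewrite /mq ge_min lexx.
have mq2 : mq <= 2 * pi - (r c - r q) by rewrite /mq ge_min lexx orbT.
have A0 : 0 <= 2 * pi - r p by lra.
have B0 := ltW q0.
(* The shorter arc from [a] to [c] is compared with the arcs from [p] and [q] in
   the same direction. *)
have [rl|rl] := leP (r c) (2 * pi - r c).
  apply: le_trans (lerD (ler_wpM2l B0 mp2) (ler_wpM2l A0 mq1)) _; nra.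
apply: le_trans (lerD (ler_wpM2l B0 mp1) (ler_wpM2l A0 mq2)) _; nra.
Qed.

Lemma squeeze s (P : seq R) a : P != [::] ->
  (forall c, c \in P -> carrier s c) -> carrier s a ->
  a \notin P -> squeezed s P a.
Proof.
by case: s => P0 PT aT aP; [apply: squeeze_real|apply: squeeze_circle].
Qed.

Definition move_value (a p u : R) : R := if u == a then p else u.

(** Moving all occurrences of [a] at once keeps null the distance between two of
    them, so that the inequality also holds for such pairs. *)
Lemma move_values s (P : seq R) a p q A B : a \notin P ->
  (forall c, c \in P ->
      B * dist s p c + A * dist s q c <= (A + B) * dist s a c) ->
  forall u v, u \in a :: P -> v \in a :: P ->
  B * dist s (move_value a p u) (move_value a p v)
  + A * dist s (move_value a q u) (move_value a q v) <= (A + B) * dist s u v.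
Proof.
move=> aP sq u v; rewrite /move_value !inE.
have [-> _|ua /= uP] := eqVneq u a; have [-> _|va /= vP] := eqVneq v a.
- by rewrite !dist_refl !mulr0 addr0.
- exact: sq.
- by rewrite ![dist s u _]dist_sym; apply: sq.
- by rewrite -mulrDl addrC.
Qed.

Lemma sum_combination (I : finType) (A B : R) (F G H : I -> R) :
  (forall i, B * F i + A * G i <= (A + B) * H i) ->
  B * (\sum_i F i) + A * (\sum_i G i) <= (A + B) * (\sum_i H i).
Proof.
move=> FGH; rewrite !mulr_sumr -big_split.
by apply: ler_sum => i _; apply: FGH.
Qed.

(** The weighted mean of the energies after the moves to [p] and to [q] is at
    most the original energy, hence so is the smaller one. *)
Lemma energy_move_value s N alpha (w y z : N.-tuple R) (P : seq R) a :
  0 <= alpha -> (forall i, 0 <= tnth w i) ->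
  {subset y <= P} -> {subset z <= a :: P} -> a \notin P -> squeezed s P a ->
  exists2 p, p \in P &
    energy s alpha w y (map_tuple (move_value a p) z) <= energy s alpha w y z.
Proof.
move=> al0 w0 yP zP aP [p [q [A [B [pP qP [A0 B0] AB sq]]]]].
have mv := move_values aP sq.
have yE b i : move_value a b (tnth y i) = tnth y i.
  rewrite /move_value; case: eqP => // E.
  by move: aP; rewrite -E (yP _ (mem_tnth i y)).
pose E b := energy s alpha w y (map_tuple (move_value a b) z).
have EC : B * E p + A * E q <= (A + B) * energy s alpha w y z.
  have edges : B * (\sum_(i < N.-1) dist s (map (move_value a p) z)`_i
                                          (map (move_value a p) z)`_i.+1)
    + A * (\sum_(i < N.-1) dist s (map (move_value a q) z)`_i
                                   (map (move_value a q) z)`_i.+1)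
    <= (A + B) * (\sum_(i < N.-1) dist s z`_i z`_i.+1).
    apply: sum_combination => i; have := ltn_ord i => iN.
    have iz : (i < size z)%N by rewrite size_tuple; lia.
    have i1z : (i.+1 < size z)%N by rewrite size_tuple; lia.
    by rewrite !(nth_map 0) //; apply: mv; apply: zP; apply: mem_nth.
  have data : B * (\sum_(i < N) tnth w i
      * dist s (tnth (map_tuple (move_value a p) z) i) (tnth y i))
    + A * (\sum_(i < N) tnth w i
      * dist s (tnth (map_tuple (move_value a q) z) i) (tnth y i))
    <= (A + B) * (\sum_(i < N) tnth w i * dist s (tnth z i) (tnth y i)).
    apply: sum_combination => i; rewrite !(mulrCA _ (tnth w i)) -mulrDr.
    have yi : tnth y i \in a :: P by rewrite inE yP ?orbT // mem_tnth.
    have := mv _ _ (zP _ (mem_tnth i z)) yi; rewrite !yE => mvz.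
    by rewrite ler_wpM2l // !tnth_map.
  have := lerD (ler_wpM2l al0 edges) data.
  apply: etrans; rewrite /E /energy /=; congr (_ <= _); ring.
have [Ep|Ep] := leP (E p) (energy s alpha w y z); first by exists p.
exists q => //; rewrite leNgt; apply/negP => Eq.
set e := energy s alpha w y z in EC Ep Eq.
pose m := Num.min (E p) (E q).
have em : e < m by rewrite lt_min Ep.
have mp : B * m <= B * E p by rewrite ler_wpM2l // /m ge_min lexx.
have mq : A * m <= A * E q by rewrite ler_wpM2l // /m ge_min lexx orbT.
have : (A + B) * e < (A + B) * m by rewrite ltr_pM2l.
by rewrite ltNge => /negP; apply; lra.
Qed.

(** The list [L] of spare values, initially all the values of [z], is emptied
    one value at a time. *)
Lemma data_values_suffice s N alpha (w y z : N.-tuple R) :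
  (0 < N)%N -> 0 <= alpha -> (forall i, 0 <= tnth w i) ->
  signals s y -> signals s z ->
  exists2 x : N.-tuple R, {subset x <= y} &
    energy s alpha w y x <= energy s alpha w y z.
Proof.
move=> N0 al0 w0 yT zT.
have inT (t : N.-tuple R) : signals s t -> forall c, c \in t -> carrier s c.
  by move=> tT c /tnthP[i ->]; apply: tT.
suff reduce (L : seq R) (u : N.-tuple R) :
    (forall c, c \in L -> carrier s c) -> {subset u <= y ++ L} ->
    exists2 x : N.-tuple R, {subset x <= y} &
      energy s alpha w y x <= energy s alpha w y u.
  by apply: (reduce z); [apply: inT|move=> c cz; rewrite mem_cat cz orbT].
elim: L u => [|a L IH] u LT uL; first by exists u => // c /uL; rewrite cats0.
have LT' c : c \in L -> carrier s c.
  by move=> cL; apply: LT; rewrite inE cL orbT.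
have uL' : {subset u <= a :: y ++ L}.
  by move=> c /uL; rewrite !(inE, mem_cat) orbCA.
have [aP|aP] := boolP (a \in y ++ L).
  by apply: IH => // c /uL'; rewrite inE => /predU1P[->|].
have yP : {subset y <= y ++ L} by move=> c cy; rewrite mem_cat cy.
have sq : squeezed s (y ++ L) a.
  apply: squeeze aP; last by apply: LT; apply: mem_head.
    by rewrite -size_eq0 size_cat size_tuple; lia.
  by move=> c; rewrite mem_cat => /orP[/(inT _ yT)|/LT'].
have [p pP Ep] := energy_move_value al0 w0 yP uL' aP sq.
have [c|x xy Ex] := IH (map_tuple (move_value a p) u) LT'.
  case/mapP => b /uL'; rewrite /move_value inE.
  by case: eqVneq => [_ _ ->|_ /= bP ->].
by exists x => //; apply: le_trans Ex Ep.
Qed.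

(** * The distance transform on the line *)

Implicit Types v B D E : seq R.

(** Attainment is stated as an inequality: together with the lower bounds it
    gives equality, and it is the half that survives every relaxation. *)
Definition is_dist_trans s alpha v B D : Prop :=
  size D = size v /\ forall i, (i < size v)%N ->
    (forall j, (j < size v)%N -> D`_i <= B`_j + alpha * dist s v`_i v`_j) /\
    (exists2 j, (j < size v)%N & B`_j + alpha * dist s v`_i v`_j <= D`_i).

Definition relaxation alpha j k (h : R) D : seq R :=
  set_nth 0 D k (Num.min (D`_j + alpha * h) D`_k).

Lemma runs_relax alpha j k (a b : R) D (Q : seq R -> Prop) :
  Q (relaxation alpha j k (a - b) D) ->
  runs (let* h := subM a b in relax alpha j k h D) 5 Q.
Proof. by []. Qed.

(** The properties that a relaxation preserves whatever the order in which the
    entries are visited, provided that it charges at least the gap. *)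
Definition relaxed alpha v B D : Prop :=
  [/\ size D = size v,
      forall i, (i < size v)%N -> D`_i <= B`_i &
      forall i, (i < size v)%N ->
        exists2 j, (j < size v)%N & B`_j + alpha * `|v`_i - v`_j| <= D`_i].

(** By the triangle inequality, a value that has travelled from [l] to [j] and
    then from [j] to [k] is no smaller than a direct transport from [l]. *)
Lemma relax_relaxed alpha v B D j k (h : R) : 0 <= alpha ->
  (j < size v)%N -> (k < size v)%N -> `|v`_k - v`_j| <= h ->
  relaxed alpha v B D -> relaxed alpha v B (relaxation alpha j k h D).
Proof.
move=> al0 jv kv hkj [sD DB DA]; rewrite /relaxation; split.
- by rewrite size_set_nth sD; lia.
- move=> i iv; rewrite nth_set_nth /=; case: eqP => [->|_]; last exact: DB.
  by rewrite ge_min DB ?orbT.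
- move=> i iv; rewrite nth_set_nth /=; case: eqP => [->|_]; last exact: DA.
  have [_|_] := leP; last exact: DA.
  have [l lv Dl] := DA j jv; exists l => //.
  apply: le_trans (lerD Dl (ler_wpM2l al0 hkj)).
  by rewrite -addrA lerD2l -mulrDr ler_wpM2l // [leRHS]addrC ler_distD.
Qed.

(** Bounds between consecutive entries add up, as the gaps of a sorted array
    do. *)
Lemma lipschitz_path alpha v D i d : 0 <= alpha ->
  (forall k, (k.+1 < size v)%N -> v`_k <= v`_k.+1) ->
  (forall k, (k.+1 < size v)%N ->
     `|D`_k.+1 - D`_k| <= alpha * (v`_k.+1 - v`_k)) ->
  (i + d < size v)%N ->
  v`_i <= v`_(i + d) /\ `|D`_(i + d) - D`_i| <= alpha * (v`_(i + d) - v`_i).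
Proof.
move=> al0 vs Ds; elim: d => [|d IH] idv.
  by rewrite addn0 !subrr normr0 mulr0.
rewrite addnS in idv *; have [|v1 D1] := IH; first lia.
have v2 := vs _ idv; have D2 := Ds _ idv; split; first exact: le_trans v2.
apply: le_trans (ler_distD D`_(i + d) _ _) _.
apply: le_trans (lerD D2 D1) _; rewrite -mulrDr ler_wpM2l //; lra.
Qed.

(** The forward pass makes every entry at most its left neighbour plus the cost
    of the gap, and the backward pass does the same with right neighbours
    without destroying the former property, as lowering [D_k] down to
    [D_(k+1)] plus a nonnegative amount leaves [D_(k+1)] below the new [D_k].
    The result is thus [alpha]-Lipschitz and below [B], which gives the upper
    bounds; attainment is kept by [relaxed]. *)
Lemma runs_distTransReal alpha B v : 0 <= alpha -> sorted <=%R v ->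
  (0 < size v)%N -> size B = size v ->
  runs (distTransReal B v alpha) (11 * size v)
    (is_dist_trans RealValued alpha v B).
Proof.
move=> al0 vS v0 sB.
have vs k : (k.+1 < size v)%N -> v`_k <= v`_k.+1.
  by move=> kv; apply: (sortedP 0 vS).
have step0 k : (k.+1 < size v)%N -> 0 <= alpha * (v`_k.+1 - v`_k).
  by move=> kv; rewrite mulr_ge0 // subr_ge0 vs.
pose up k D := relaxed alpha v B D /\
  forall i, (i.+1 < k)%N -> D`_i.+1 <= D`_i + alpha * (v`_i.+1 - v`_i).
pose down k D := relaxed alpha v B D /\
  (forall i, (i.+1 < size v)%N -> D`_i.+1 <= D`_i + alpha * (v`_i.+1 - v`_i)) /\
  forall i, (k <= i)%N -> (i.+1 < size v)%N ->
    D`_i <= D`_i.+1 + alpha * (v`_i.+1 - v`_i).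
(* The bound is split along the sequence of calls; the last summand is slack. *)
have -> : (11 * size v = size v + ((size v).-1 * 5 + ((size v).-1 * 5 + 10)))%N.
  lia.
have copyB : runs (copyM B) (size v) (eq B) by rewrite -sB; apply: runs_copy.
apply: runs_bind copyB _ => _ <-; apply: runs_bind.
  apply: (runs_for_up (P := up)).
    split; last by [].
    split=> // i iv; exists i => //; by rewrite subrr normr0 mulr0 addr0.
  move=> [//|k] D kv [rel lip].
  apply: runs_relax; split.
    apply: relax_relaxed => //; try lia.
    by rewrite ger0_norm // subr_ge0 vs //; lia.
  move=> i ik; rewrite /relaxation !nth_set_nth /=.
  have -> : (i == k.+1) = false by lia.
  rewrite eqSS; case: eqP => [->|ik']; first by rewrite ge_min lexx.
  by apply: lip; lia.
rewrite add1n prednK // => D1 [rel1 lip1].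
apply: (@runs_weaken _ _ ((size v).-1 * 5) _ (down 0%N)); [|lia|].
  apply: (runs_for_down (P := down)).
    by split=> //; split=> // i; lia.
  move=> k D kv [rel [lip lop]]; have kv' : (k.+1 < size v)%N by lia.
  apply: runs_relax; split.
    apply: relax_relaxed => //; try lia.
    by rewrite distrC ger0_norm // subr_ge0 vs //; lia.
  split=> i; rewrite /relaxation !nth_set_nth /=.
    move=> iv; case: eqP => [ik|_]; case: eqP => [ik'|_].
    - lia.
    - by rewrite ge_min -ik lip ?orbT // ik.
    - move: iv; rewrite ik' => iv; have := step0 _ iv; have := lip _ iv.
      by case: (leP _ D`_k) => _; lra.
    - exact: lip.
  move=> ki iv; have -> : (i.+1 == k) = false by lia.
  case: eqP => [->|ik]; first by rewrite ge_min lexx.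
  by apply: lop => //; lia.
move=> D [[sD DB DA] [lip lop]]; split=> // i iv; split; last exact: DA.
have Ds k : (k.+1 < size v)%N -> `|D`_k.+1 - D`_k| <= alpha * (v`_k.+1 - v`_k).
  by move=> kv; have := lip _ kv; have := lop _ isT kv; rewrite ler_norml; lra.
move=> j jv; apply: (@le_trans _ _ (D`_j + alpha * `|v`_i - v`_j|)).
  rewrite -lerBlDl; apply: le_trans (ler_norm _) _.
  have [ij|ji] := leqP i j.
    have [] := @lipschitz_path alpha v D i (j - i) al0 vs Ds.
      by rewrite subnKC.
    rewrite subnKC // => vij; rewrite distrC => /le_trans; apply.
    by rewrite ler_wpM2l // distrC ler_norm.
  have [] := @lipschitz_path alpha v D j (i - j) al0 vs Ds.
    by rewrite subnKC // ltnW.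
  rewrite subnKC ?(ltnW ji) // => vij => /le_trans; apply.
  by rewrite ler_wpM2l // ler_norm.
by rewrite lerD2r DB.
Qed.

(** * The distance transform on the circle *)

Lemma nth_cat3 (a b c : seq R) i : size b = size a -> (i < size a)%N ->
  [/\ (a ++ b ++ c)`_i = a`_i, (a ++ b ++ c)`_(size a + i) = b`_i &
      (a ++ b ++ c)`_(size a + (size a + i)) = c`_i].
Proof.
have skip (a1 a2 : seq R) j : (a1 ++ a2)`_(size a1 + j) = a2`_j.
  by rewrite nth_cat ltnNge leq_addr /= addKn.
move=> ba ia; rewrite !skip -ba !skip; split=> //.
  by rewrite nth_cat ia.
by rewrite nth_cat ba ia.
Qed.

(** In the array of lifts, the minimum for the middle copy of [v_i] runs over
    all the lifts of all the [v_j], and the nearest lift of [v_j] is at the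
    arc distance from [v_i]. *)
Lemma runs_distTransCirc alpha B v : 0 <= alpha -> sorted <=%R v ->
  (0 < size v)%N -> size B = size v ->
  (forall t, t \in v -> carrier CircleValued t) ->
  runs (distTransCirc B v alpha) (43 * size v)
    (is_dist_trans CircleValued alpha v B).
Proof.
move=> al0 vS v0 sB vT; set K := size v.
have carrier_nth i : (i < K)%N -> - pi < v`_i <= pi.
  by move=> iK; apply: vT; apply: mem_nth.
have gap i j : (i < K)%N -> (j < K)%N -> `|v`_i - v`_j| <= 2 * pi.
  move=> /carrier_nth /andP[? ?] /carrier_nth /andP[? ?].
  by rewrite ler_norml; lra.
have -> : (43 * K = K * 3 +
    (1 + (K * 2 + (K + (K * 2 + (33 * K + (2 * K - 1)))))))%N.
  by move: v0; rewrite -/K; lia.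
have copyB : runs (copyM (B ++ B ++ B)) (K * 3) (eq (B ++ B ++ B)).
  have -> : (K * 3 = size (B ++ B ++ B))%N by rewrite !size_cat sB -/K; lia.
  exact: runs_copy.
apply: runs_bind copyB _ => _ <-.
apply: (@runs_bind _ _ _ _ _ _ (eq (2 * pi))) => [//|_ <-].
apply: runs_bind; first by apply: (@runs_map _ _ _ (fun t => t - 2 * pi) 1).
move=> _ <-; apply: runs_bind; first exact: runs_copy.
move=> _ <-; apply: runs_bind.
  by apply: (@runs_map _ _ _ (fun t => t + 2 * pi) 1).
move=> _ <-.
set vl := map _ v; set vr := map _ v; set v3 := vl ++ v ++ vr.
have svl : size vl = K by rewrite size_map.
have svr : size vr = K by rewrite size_map.
have sv3 : size v3 = (K + (K + K))%N by rewrite !size_cat svl svr.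
have v3P i : (i < K)%N ->
    [/\ v3`_i = v`_i - 2 * pi, v3`_(K + i) = v`_i &
        v3`_(K + (K + i)) = v`_i + 2 * pi].
  move=> iK; have [] := @nth_cat3 vl v vr i; rewrite ?svl // => -> -> ->.
  by split=> //; rewrite (nth_map 0).
have B3P i : (i < K)%N -> [/\ (B ++ B ++ B)`_i = B`_i,
    (B ++ B ++ B)`_(K + i) = B`_i & (B ++ B ++ B)`_(K + (K + i)) = B`_i].
  by move=> iK; have [] := @nth_cat3 B B B i; rewrite ?sB.
have shifted i e : (i < K)%N -> e \in [:: - (2 * pi); 0; 2 * pi] ->
    exists2 j, (j < size v3)%N &
      v3`_j = v`_i + e /\ (B ++ B ++ B)`_j = B`_i.
  move=> iK; have [v1 v2 v4] := v3P i iK; have [b1 b2 b3] := B3P i iK.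
  rewrite !inE => /or3P[] /eqP ->.
  - by exists i; rewrite ?sv3; [lia|].
  - by exists (K + i)%N; rewrite ?sv3 ?addr0; [lia|].
  - by exists (K + (K + i))%N; rewrite ?sv3; [lia|].
have unshifted j : (j < size v3)%N ->
    exists2 i, (i < K)%N & exists2 e, e \in [:: - (2 * pi); 0; 2 * pi] &
      v3`_j = v`_i + e /\ (B ++ B ++ B)`_j = B`_i.
  rewrite sv3 => jK; pose i := (j %% K)%N.
  have iK : (i < K)%N by rewrite ltn_mod.
  have [v1 v2 v4] := v3P i iK; have [b1 b2 b3] := B3P i iK.
  exists i => //.
  have : j = i \/ j = (K + i)%N \/ j = (K + (K + i))%N.
    have := divn_eq j K; rewrite -/i.
    case: (j %/ K)%N => [|[|[|q]]] jE; [left|right; left|right; right|]; lia.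
  move=> [->|[->|->]]; [exists (- (2 * pi))|exists 0|exists (2 * pi)];
    by rewrite ?inE ?eqxx ?orbT ?addr0.
have v3S : sorted <=%R v3.
  have tle : transitive (<=%R : rel R) by apply: le_trans.
  rewrite (sorted_pairwise tle) !pairwise_cat !pairwise_map.
  have pvS : pairwise <=%R v by rewrite -(sorted_pairwise tle).
  have pv e : pairwise (relpre (+%R^~ e) <=%R) v.
    by apply: sub_pairwise pvS => a b; rewrite /= lerD2r.
  rewrite !pv pvS /= !andbT; apply/andP; split; apply/allrelP => a b.
    case/mapP => t /vT /= /andP[? ?] ->.
    rewrite mem_cat => /orP[/vT/= /andP[? ?]|].
      lra.
    by case/mapP => u /vT /= /andP[? ?] ->; lra.
  by move=> /vT/= /andP[? ?] /mapP[u /vT/= /andP[? ?] ->]; lra.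
apply: runs_bind.
  have := @runs_distTransReal alpha (B ++ B ++ B) v3 al0 v3S.
  have -> : (11 * size v3 = 33 * K)%N by rewrite sv3; lia.
  by apply; rewrite ?sv3 ?size_cat ?sB -/K //; move: v0; rewrite -/K; lia.
move=> D [sD DP].
have sD' : size (take K (drop K D)) = K.
  by rewrite size_take size_drop sD sv3; case: ltnP; lia.
apply: (@runs_weaken _ _ K _ (eq (take K (drop K D)))); last 1 first.
- move=> _ <-; split=> // i iK.
  have -> : (take K (drop K D))`_i = D`_(K + i) by rewrite nth_take // nth_drop.
  have [|ub [j jv lb]] := DP (K + i)%N; first by rewrite sv3; lia.
  have [_ vi _] := v3P i iK; rewrite /= vi in ub lb; split=> [j' j'K|].
    have [e eI de] := dist_circle_attained (gap _ _ iK j'K).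
    have [l lv [vl' Bl]] := shifted j' e j'K eI.
    apply: le_trans (ub l lv) _; rewrite vl' Bl lerD2l ler_wpM2l //.
  have [l lK [e eI [vl' Bl]]] := unshifted j jv.
  exists l => //; apply: le_trans lb; rewrite vl' Bl lerD2l ler_wpM2l //.
  exact: dist_circle_shift (gap _ _ iK lK) eI.
- by have := runs_copy (take K (drop K D)); rewrite sD'.
- by move: v0; rewrite -/K; lia.
Qed.

Lemma runs_distTrans s alpha B v : 0 <= alpha -> sorted <=%R v ->
  (0 < size v)%N -> size B = size v -> (forall t, t \in v -> carrier s t) ->
  runs (distTrans s B v alpha) (43 * size v) (is_dist_trans s alpha v B).
Proof.
case: s => al0 vS v0 sB vT; last exact: runs_distTransCirc.
by apply: runs_weaken (runs_distTransReal al0 vS v0 sB) _ _ => //; lia.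
Qed.

(** * The candidate values *)

(** An inserted entry is compared with those before it, at two operations each,
    and shifts those after it, at one operation each. *)
Lemma runs_insert a v : sorted <%R v ->
  runs (insertM a v) (2 * size v + 1)
    (fun u => sorted <%R u /\ u =i a :: v).
Proof.
elim: v => [|b v IH] vS.
  by apply: runs_weaken (runs_copy [:: a]) _ _ => // _ <-.
have lt_trans' : transitive (<%R : rel R) by apply: lt_trans.
rewrite /runs [insertM _ _]/=.
have [ab|ba|ab] := ltgtP a b.
- have := runs_copy [:: a, b & v]; rewrite /runs.
  case: (copyM _) => u cu /= [<- cuv]; split; last by lia.
  by split=> //=; rewrite ab.
- have := vS; rewrite /= path_sortedE // => /andP[bv vS'].
  have [[uS uE] uc] := IH vS'.
  rewrite /bind; case: (insertM a v) uS uE uc => u' cu /= uS uE uc.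
  split; last lia; split.
    by rewrite /= path_sortedE // uS (eq_all_r uE) /= ba bv.
  by move=> t; rewrite !inE uE inE orbCA.
- split; last by rewrite /=; lia.
  by split=> // t; rewrite /= !inE ab orbA orbb.
Qed.

Lemma runs_values s (y : seq R) :
  runs (valuesM s y) (3 * size y) (eq (values s y)).
Proof.
have antipodeE (t : R) : antipodeM t = (antipode t, 2%N).
  by rewrite /antipodeM /antipode /=; case: ifP.
case: s => /=; first by split.
rewrite -[(3 * size y)%N]addn0 mulnC.
by apply: runs_bind (runs_map y antipodeE) _ => _ <-; split.
Qed.

Lemma size_candidates s (y v : seq R) :
  sorted <%R v -> v =i values s y -> size v = nb_values s y.
Proof.
move=> vS vE; apply/perm_size/uniq_perm; rewrite ?undup_uniq ?lt_sorted_uniq //.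
by move=> t; rewrite mem_undup vE.
Qed.

Lemma nb_values_gt0 s (y : seq R) : (0 < size y)%N -> (0 < nb_values s y)%N.
Proof.
rewrite /nb_values; case: y => // t y _; rewrite lt0n size_eq0.
apply/eqP => E; have : t \in undup (values s (t :: y)).
  by rewrite mem_undup; case: s {E} => /=; rewrite ?mem_cat mem_head.
by rewrite E.
Qed.

Lemma size_values s (y : seq R) : (size (values s y) <= 2 * size y)%N.
Proof. by case: s => /=; rewrite ?size_cat ?size_map; lia. Qed.

(** The array never has more than [nb_values s y] entries, since it is free of
    repetitions; so each of the at most [2 * size y] insertions costs at most
    three times that number. *)
Lemma runs_candidates s (y : seq R) : (0 < size y)%N ->
  runs (candidates s y) (9 * (nb_values s y * size y))
    (fun v => sorted <%R v /\ v =i values s y).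
Proof.
move=> y0; set K := nb_values s y; set z := values s y.
have K0 : (0 < K)%N := nb_values_gt0 s y0.
have z2 : (size z <= 2 * size y)%N := size_values s y.
pose inserted n v := sorted <%R v /\ v =i take n z.
apply: (@runs_weaken _ _ (3 * size y + size z * (2 * K + 1)) _
  (inserted (size z))).
- apply: runs_bind (runs_values s y) _ => _ <-.
  rewrite -[X in inserted X]add0n; apply: runs_for_up => [|n v nz [vS vE]].
    by split=> // t; rewrite take0.
  have vK : (size v <= K)%N.
    apply: uniq_leq_size; first exact: lt_sorted_uniq.
    by move=> t; rewrite vE mem_undup => /mem_take.
  apply: runs_weaken (runs_insert z`_n vS) _ _; first lia.
  move=> u [uS uE]; split=> // t.
  by rewrite uE (take_nth 0) // mem_rcons !inE vE.
- nia.
- by move=> v [vS vE]; split=> // t; rewrite vE take_size.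
Qed.

Lemma values_data s (y : seq R) : {subset y <= values s y}.
Proof. by case: s => t ty //=; rewrite mem_cat ty. Qed.

Lemma values_carrier s (y : seq R) :
  (forall t, t \in y -> carrier s t) ->
  forall t, t \in values s y -> carrier s t.
Proof.
case: s => yT t //=; rewrite mem_cat => /orP[/yT//|/mapP[u /yT /= uT ->]].
have pi0 := pi_gt0 R; move/andP: uT => [u1 u2].
by rewrite /antipode; case: (ltP 0 u) => u0; apply/andP; split; lra.
Qed.

(** * Minimal indices *)

Lemma runs_argmin E : (0 < size E)%N ->
  runs (argminM E) (4 * size E) (fun ls => ls != [::] /\
    forall l, l \in ls -> (l < size E)%N /\
      forall k, (k < size E)%N -> E`_l <= E`_k).
Proof.
move=> E0.
have -> : (4 * size E = 1 + ((size E).-1 * 2 + (size E * 2 + 1)))%N by lia.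
pose least n m := (exists2 l, (l < size E)%N & E`_l = m) /\
  forall k, (k < n)%N -> m <= E`_k.
apply: (@runs_bind _ _ _ _ _ _ (eq E`_0)) => [//|_ <-].
apply: (@runs_bind _ _ _ _ _ _ (least (size E))).
  have -> : least (size E) = least (1 + (size E).-1)%N by rewrite add1n prednK.
  apply: (runs_for_up (P := least)) => [|n m nE [[l lE lm] mk]].
    by split; [exists 0%N|case].
  split=> //=; case: ltP => [nm|mn]; split.
  - by exists n => //; lia.
  - move=> k; rewrite ltnS leq_eqVlt => /predU1P[->//|kn].
    by apply: le_trans (ltW nm) _; apply: mk.
  - by exists l.
  - by move=> k; rewrite ltnS leq_eqVlt => /predU1P[->//|kn]; apply: mk.
move=> m [[l lE lm] mk].
pose found n ls := ls = [seq k <- iota 0 n | E`_k == m].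
apply: (@runs_weaken _ _ (size E * 2) _ (found (size E))); last 1 first.
- move=> ls ->; split.
    have : l \in [seq k <- iota 0 (size E) | E`_k == m].
      by rewrite mem_filter lm eqxx mem_iota.
    by case: filter.
  move=> k; rewrite mem_filter mem_iota add0n => /andP[/eqP -> kE].
  by split.
- rewrite -[X in found X]add0n; apply: runs_for_up => // n ls _ ->.
  have foundS : [seq k <- iota 0 n.+1 | E`_k == m] =
      [seq k <- iota 0 n | E`_k == m] ++ (if E`_n == m then [:: n] else [::]).
    by rewrite -addn1 iotaD filter_cat /= add0n.
  by split=> /=; rewrite /found ?foundS; case: ifP => _; rewrite ?cats0 ?cats1.
- by lia.
Qed.

Lemma runs_choose (ch : nat -> seq nat -> nat) n E : selection ch ->
  (0 < size E)%N ->
  runs (chooseM ch n E) (4 * size E + 1) (fun l => (l < size E)%N /\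
    forall k, (k < size E)%N -> E`_l <= E`_k).
Proof.
move=> chP E0; apply: runs_bind (runs_argmin E0) _ => ls [ls0 lsP].
by split=> //=; apply: lsP; apply: chP.
Qed.

(** * Tabulation and backtracking *)

Section DynamicProgram.
Variables (s : signal) (alpha : R) (w y v : seq R).

Definition data_term n (t : R) : R := w`_n * dist s t y`_n.

(** The number [n] is the index of the last entry of the prefix. *)
Definition prefix_energy n (x : seq R) : R :=
  alpha * (\sum_(i < n) dist s x`_i x`_i.+1) + \sum_(i < n.+1) data_term i x`_i.

Lemma prefix_energy0 x : prefix_energy 0 x = data_term 0 x`_0.
Proof. by rewrite /prefix_energy big_ord0 mulr0 add0r big_ord1. Qed.

Lemma prefix_energyS n x : prefix_energy n.+1 x =
  data_term n.+1 x`_n.+1 + (prefix_energy n x + alpha * dist s x`_n x`_n.+1).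
Proof.
rewrite /prefix_energy big_ord_recr [in LHS](big_ord_recr n.+1) /=; ring.
Qed.

Definition tabulated n (Bs : seq (seq R)) : Prop :=
  [/\ size Bs = n, forall m, (m < n)%N -> size (nth [::] Bs m) = size v,
      forall k, (k < size v)%N -> (nth [::] Bs 0)`_k = data_term 0 v`_k &
      forall m, (m.+1 < n)%N ->
        exists2 D, is_dist_trans s alpha v (nth [::] Bs m) D &
          forall k, (k < size v)%N ->
            (nth [::] Bs m.+1)`_k = data_term m.+1 v`_k + D`_k].

(** The table row [n] as a function of the candidate value instead of its index:
    the least energy of a prefix that ends with [t] at time [n]. *)
Definition opt (Bs : seq (seq R)) n (t : R) : R := (nth [::] Bs n)`_(index t v).

Lemma opt_le_prefix_energy Bs (z : seq R) n :
  tabulated (size y) Bs -> size z = size y -> {subset z <= v} ->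
  (n < size y)%N -> opt Bs n z`_n <= prefix_energy n z.
Proof.
move=> [_ _ B0 BS] zy zv.
have zV i : (i < size y)%N -> z`_i \in v.
  by move=> iy; apply: zv; apply: mem_nth; rewrite zy.
have idx i : (i < size y)%N -> (index (z`_i)%R v < size v)%N.
  by move=> /zV; rewrite index_mem.
elim: n => [|n IH] ny.
  by rewrite prefix_energy0 /opt B0 ?nth_index ?idx ?zV.
have ny' : (n < size y)%N by lia.
have [D [_ DP] BD] := BS n ny; rewrite prefix_energyS /opt BD ?idx //.
rewrite nth_index ?zV // lerD2l.
have [ub _] := DP _ (idx _ ny); apply: le_trans (ub _ (idx _ ny')) _.
by rewrite !nth_index ?zV // lerD ?IH // dist_sym.
Qed.

(** The invariant of backtracking, where [x] starts at time [n].  It speaks of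
    table values only, so it holds for every choice among minimal indices. *)
Definition traced Bs n (x : seq R) : Prop :=
  [/\ (n + size x)%N = size y, x != [::], {subset x <= v},
      forall t, t \in v ->
        opt Bs (size y).-1 (last 0 x) <= opt Bs (size y).-1 t &
      forall j, (j.+1 < size x)%N -> opt Bs (n + j).+1 x`_j.+1 =
        data_term (n + j).+1 x`_j.+1
        + (opt Bs (n + j) x`_j + alpha * dist s x`_j x`_j.+1)].

Lemma opt_traced Bs (x : seq R) n :
  tabulated (size y) Bs -> traced Bs 0 x -> (n < size y)%N ->
  opt Bs n x`_n = prefix_energy n x.
Proof.
move=> [_ _ B0 _] [xy _ xv _ xS].
elim: n => [|n IH] ny.
  have xV : x`_0 \in v by apply: xv; apply: mem_nth; rewrite -xy in ny.
  by rewrite prefix_energy0 /opt B0 ?index_mem // nth_index.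
rewrite prefix_energyS -IH; last lia.
by apply: (xS n); rewrite -xy in ny.
Qed.

Hypotheses (alpha_ge0 : 0 <= alpha) (y_gt0 : (0 < size y)%N).
Hypotheses (v_sorted : sorted <%R v) (v_gt0 : (0 < size v)%N).

Lemma opt_nth Bs n k : (k < size v)%N -> opt Bs n v`_k = (nth [::] Bs n)`_k.
Proof. by move=> kK; rewrite /opt index_uniq // lt_sorted_uniq. Qed.

Lemma runs_tabulate : (forall t, t \in v -> carrier s t) ->
  runs (tabulate s alpha w y v) (47 * (size v * size y)) (tabulated (size y)).
Proof.
move=> v_carrier.
have -> : (47 * (size v * size y) = size v * 3 +
    ((size y).-1 * (43 * size v + (size v * 4 + 0)) + 44 * size v))%N.
  by case: (size y) y_gt0 => // n _ /=; nia.
apply: runs_bind.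
  by apply: (runs_tab (g := fun k => data_term 0 v`_k) (c := 2)).
move=> _ <-; apply: (runs_le (leq_addr _ _)).
have -> : tabulated (size y) = tabulated (1 + (size y).-1).
  by rewrite add1n prednK.
apply: (runs_for_up (P := tabulated)) => [|[//|n] Bs nN [sBs sB B0 BS]].
  split=> //= [[|m] //|k kK]; by rewrite ?size_mkseq ?nth_mkseq.
apply: runs_bind.
  apply: runs_distTrans => //.
  - by apply: (@sub_sorted _ <%R) v_sorted => a b; apply: ltW.
  - by apply: sB; lia.
rewrite /= => D DP; apply: runs_bind.
  by apply: (runs_tab (g := fun k => data_term n.+1 v`_k + D`_k) (c := 3)).
move=> _ <-; split=> //; split=> /=.
- by rewrite size_rcons sBs.
- move=> m mn; rewrite nth_rcons sBs; have [mn'|mn'|_] := ltngtP m n.+1.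
  + exact: sB.
  + by lia.
  + by rewrite size_mkseq.
- by move=> k kK; rewrite nth_rcons sBs /= B0.
- move=> m mn; rewrite !nth_rcons sBs.
  have mn' : (m < n.+1)%N by lia.
  rewrite mn'; have [mn1|mn1|[->]] := ltngtP m.+1 n.+1.
  + exact: BS.
  + by lia.
  + by exists D => // k kK; rewrite nth_mkseq.
Qed.

(** The minimum searched by a backtracking step is, by symmetry of the distance,
    the one that the distance transform has computed for [x_(n+1)]; hence any
    minimal index satisfies the recursion with equality. *)
Lemma runs_backtrack (Bs : seq (seq R)) (ch : nat -> seq nat -> nat) :
  tabulated (size y) Bs -> selection ch ->
  runs (backtrack ch s alpha (size y) v Bs) (10 * (size v * size y))
    (traced Bs 0).
Proof.
move=> [_ sB _ BS] chP; have v0 := v_gt0; have y0 := y_gt0.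
have -> : (10 * (size v * size y) = (4 * size v + 1) + (1 + ((size y).-1 *
    (size v * 4 + ((4 * size v + 1) + (1 + 0))) +
    ((size v * 2 - 2) * (size y).-1 + 6 * size v - 2))))%N.
  case: (size y) y0 => // n _ /=; nia.
apply: runs_bind.
  have := @runs_choose ch (size y).-1 (nth [::] Bs (size y).-1) chP.
  by rewrite sB //; [apply|lia].
move=> l [lv lmin]; apply: (@runs_bind _ _ _ _ _ _ (eq v`_l)) => [//|_ <-].
apply: (runs_le (leq_addr _ _)).
apply: runs_for_down => [|n x ny [xy x0 xv xlast xS]].
  split=> //=; first by lia.
    by move=> t; rewrite inE => /eqP ->; apply: mem_nth.
  move=> t tv; rewrite -(nth_index 0 tv) !opt_nth ?index_mem //.
  by apply: lmin; rewrite index_mem.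
case: x x0 xy xv xlast xS => // t x _ xy xv xlast xS /=.
pose E := mkseq (fun k => (nth [::] Bs n)`_k + alpha * dist s v`_k t) (size v).
apply: (@runs_bind _ _ _ _ _ _ (eq E)).
  by apply: (runs_tab (c := 3)).
move=> _ <-; have sE : size E = size v by rewrite size_mkseq.
have Ek k : (k < size v)%N ->
    E`_k = (nth [::] Bs n)`_k + alpha * dist s v`_k t.
  by move=> kv; rewrite nth_mkseq.
apply: runs_bind.
  by have := @runs_choose ch n E chP; rewrite sE; apply.
move=> {lv lmin l} l [lv lmin].
split=> //=; split=> //=.
- by rewrite -xy /=; lia.
- by move=> u; rewrite inE => /predU1P[->|/xv//]; apply: mem_nth.
- case=> [_|j jx] /=; last by have := xS j jx; rewrite addSnnS.
  rewrite addn0; have tv : t \in v by apply: xv; apply: mem_head.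
  have tK : (index t v < size v)%N by rewrite index_mem.
  have ny' : (n.+1 < size y)%N by lia.
  have [D [_ DP] BD] := BS n ny'.
  rewrite {1}/opt BD // nth_index // opt_nth //; congr (_ + _).
  have [ub [j jv lb]] := DP _ tK; rewrite nth_index // in ub lb.
  apply/eqP; rewrite eq_le; apply/andP; split.
    by rewrite [dist s v`_l t]dist_sym; apply: ub.
  apply: le_trans lb; rewrite -Ek // [dist s t _]dist_sym -Ek //.
  by apply: lmin; rewrite // sE.
Qed.

End DynamicProgram.

(** * Optimality and linear cost *)

Lemma energy_prefix s N alpha (w y x : N.-tuple R) : (0 < N)%N ->
  energy s alpha w y x = prefix_energy s alpha w y N.-1 x.
Proof.
case: N w y x => // N w y x _; rewrite /energy /prefix_energy /=; congr (_ + _).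
by apply: eq_bigr => i _; rewrite /data_term !(tnth_nth 0).
Qed.

(** A competitor [z] is first replaced by a signal [u] with data values; these
    are candidates, so the table bounds the energy of [u] from below by the
    energy of the traced signal. *)
Lemma runs_L1TV s N alpha (w y : N.-tuple R) (ch : nat -> seq nat -> nat) :
  (0 < N)%N -> 0 <= alpha -> (forall i, 0 <= tnth w i) -> signals s y ->
  selection ch ->
  runs (L1TV ch s alpha w y) (66 * (nb_values s y * N))
    (fun x => exists2 u : N.-tuple R,
       argmin (@signals R s N) (energy s alpha w y) u & x = u).
Proof.
move=> N0 al0 w0 yT chP; have y0 : (0 < size y)%N by rewrite size_tuple.
have yT' t : t \in (y : seq R) -> carrier s t.
  by move=> /tnthP[i ->]; apply: yT.
have -> : (66 * (nb_values s y * N) = 9 * (nb_values s y * size y) +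
    (47 * (nb_values s y * size y) + 10 * (nb_values s y * size y)))%N.
  by rewrite size_tuple; lia.
apply: runs_bind (runs_candidates s y0) _ => v [vS vE].
have vK := size_candidates vS vE.
have v0 : (0 < size v)%N by rewrite vK nb_values_gt0.
have vT t : t \in v -> carrier s t by rewrite vE; apply: values_carrier.
rewrite -vK; apply: runs_bind (runs_tabulate w al0 y0 vS v0 vT) _ => Bs tab.
apply: runs_weaken (runs_backtrack al0 y0 vS v0 tab chP) _ _ => // x tr.
have [xy x0 xv xlast _] := tr.
have xN : size x == N by rewrite -[size x]add0n xy size_tuple.
exists (Tuple xN) => //; split=> [i|z zT].
  by apply: vT; apply: xv; rewrite -/(Tuple xN : seq R) mem_tnth.
have [u uy uz] := data_values_suffice N0 al0 w0 yT zT.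
apply: le_trans uz; rewrite !energy_prefix //.
have uv : {subset u <= v}.
  by move=> t /uy ty; rewrite vE; apply: values_data.
have N1 : (N.-1 < size y)%N by rewrite size_tuple; lia.
rewrite /= -(opt_traced tab tr N1).
apply: le_trans (opt_le_prefix_energy tab _ uv N1); last first.
  by rewrite !size_tuple.
move: xlast; rewrite size_tuple (last_nth 0).
rewrite (_ : nth 0 (0 :: x) (size x) = x`_N.-1); last first.
  by rewrite (eqP xN); case: (N) N0.
by apply; apply: uv; apply: mem_nth; rewrite size_tuple; lia.
Qed.

End Algorithm.

Theorem theorem5 (R : realType) :
  (exists C : nat,
     forall (s : signal) (N : nat) (alpha : R) (w y : N.-tuple R)
            (ch : nat -> seq nat -> nat),
       (0 < N)%N -> 0 < alpha -> (forall i, 0 <= tnth w i) ->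
       signals s y -> selection ch ->
       (exists2 x : N.-tuple R,
          argmin (@signals R s N) (energy s alpha w y) x &
          (L1TV ch s alpha w y).1 = x) /\
       ((L1TV ch s alpha w y).2 <= C * (nb_values s y * N))%N) /\
  (forall (s : signal) (Q : set R), finite_set Q -> Q `<=` carrier s ->
     exists C : nat,
       forall (N : nat) (alpha : R) (w y : N.-tuple R)
              (ch : nat -> seq nat -> nat),
         (0 < N)%N -> 0 < alpha -> (forall i, 0 <= tnth w i) ->
         (forall i, Q (tnth y i)) -> selection ch ->
         ((L1TV ch s alpha w y).2 <= C * N)%N).
Proof.
split.
  exists 66%N => s N alpha w y ch N0 al0 w0 yT chP.
  exact: runs_L1TV (ltW al0) w0 yT chP.
(* The candidates lie among the values and antipodes of a fixed enumeration of
   [Q], which bounds [nb_values s y] independently of [N]. *)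
move=> s Q /finite_seqP[q ->] QT; exists (66 * (2 * size q))%N.
move=> N alpha w y ch N0 al0 w0 yQ chP.
have yT : signals s y by move=> i; apply: QT; apply: yQ.
have [_] := runs_L1TV N0 (ltW al0) w0 yT chP.
move=> /leq_trans; apply; rewrite -mulnA leq_mul2l leq_mul2r; apply/orP; right.
apply/orP; right; apply: leq_trans (size_values s q).
apply: uniq_leq_size; rewrite ?undup_uniq // => t; rewrite mem_undup.
have yq : {subset y <= q} by move=> u /tnthP[i ->]; apply: yQ.
case: s {QT yT} => /=; first exact: yq.
rewrite !mem_cat => /orP[/yq ->//|/mapP[u /yq uq ->]].
by rewrite map_f ?orbT.
Qed.
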